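(* Let $f$ be a mining and monotone decreasing graph invariant and let $G=H_1\sqcup\cdots\sqcup H_k$ with $k\geq 1$. Let $I=\{i\in\{1,\dots,k\}: f(H_i)=f(G)\}$ and $J=\{j\in\{1,\dots,k\}: vs_f(H_j)=\infty\}$. Then $vs_f(G)=\infty$ if $J=\{1,\dots,k\}$, and otherwise $$vs_f(G)=\sum_{i\in I\setminus J}vs_f(H_i)+\sum_{i\in I\cap J}|V(H_i)|.$$
   Context: All graphs are finite and simple (the graph with no vertices is allowed). An invariant is a function $f$ from graphs to $[0,\infty)$ that is constant on isomorphism classes. $\sqcup$ denotes disjoint union of graphs. $f$ is mining if $f(H_1\sqcup H_2)=\min\{f(H_1),f(H_2)\}$ for all disjoint graphs $H_1,H_2$. $f$ is monotone decreasing if $f(G)\leq f(H)$ whenever $H$ is an induced subgraph of $G$. The $f$-vertex stability number is $vs_f(G)=\min\{|X|: X\subseteq V(G),\ f(G-X)\neq f(G)\}$, and $vs_f(G)=\infty$ if $f(G-X)=f(G)$ for all $X\subseteq V(G)$ ($X=V(G)$ is allowed). *)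

(* Defs.v *)
From HB Require Import structures.
From mathcomp Require Import all_boot all_order all_algebra.
From mathcomp Require Import reals constructive_ereal.

Set Implicit Arguments.
Unset Strict Implicit.
Unset Printing Implicit Defensive.

Import Order.TTheory GRing.Theory Num.Theory.
Local Open Scope ring_scope.

Record sgraph := SGraph {
  vertex :> finType;
  edge : rel vertex;
  edge_sym : symmetric edge;
  edge_irrefl : irreflexive edge }.

Definition isomorphic (G H : sgraph) : Prop :=
  exists2 phi : G -> H,
    bijective phi & forall x y : G, edge (phi x) (phi y) = edge x y.

Section Induced.
Variables (G : sgraph) (S : {set G}).

Definition induced_edge : rel {x : G | x \in S} :=
  fun x y => edge (val x) (val y).

Lemma induced_edge_sym : symmetric induced_edge.
Proof. by move=> x y; rewrite /induced_edge edge_sym. Qed.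

Lemma induced_edge_irrefl : irreflexive induced_edge.
Proof. by move=> x; rewrite /induced_edge edge_irrefl. Qed.

Definition induced : sgraph := SGraph induced_edge_sym induced_edge_irrefl.
End Induced.

(* The graph G - X. *)
Definition delete (G : sgraph) (X : {set G}) : sgraph := induced (~: X).

Section DisjointUnion.
Variables G H : sgraph.

Definition dunion_edge : rel (G + H)%type := fun u v =>
  match u, v with
  | inl x, inl y => edge x y
  | inr x, inr y => edge x y
  | _, _ => false
  end.

Lemma dunion_edge_sym : symmetric dunion_edge.
Proof. by move=> [x|x] [y|y] //=; rewrite edge_sym. Qed.

Lemma dunion_edge_irrefl : irreflexive dunion_edge.
Proof. by move=> [x|x] /=; rewrite edge_irrefl. Qed.

Definition dunion : sgraph := SGraph dunion_edge_sym dunion_edge_irrefl.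
End DisjointUnion.

Section BigDisjointUnion.
Variables (k : nat) (H : 'I_k -> sgraph).

(* [tagged_as u v] is [tagged v] transported to the summand of [u] when both
   vertices lie in the same summand. *)
Definition bigdunion_edge : rel {i : 'I_k & H i} := fun u v =>
  (tag u == tag v) && edge (tagged u) (tagged_as u v).

Lemma bigdunion_edge_sym : symmetric bigdunion_edge.
Proof.
move=> [i x] [j y]; rewrite /bigdunion_edge /= eq_sym.
case: eqVneq => //= eq_ji; case: _ / eq_ji x => x.
by rewrite !tagged_asE edge_sym.
Qed.

Lemma bigdunion_edge_irrefl : irreflexive bigdunion_edge.
Proof.
by case=> i x; rewrite /bigdunion_edge eqxx tagged_asE edge_irrefl.
Qed.

Definition bigdunion : sgraph :=
  SGraph bigdunion_edge_sym bigdunion_edge_irrefl.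
End BigDisjointUnion.

Section Invariants.
Variables (R : realType) (f : sgraph -> R).

Definition graph_invariant : Prop :=
  (forall G, 0 <= f G) /\ (forall G H, isomorphic G H -> f G = f H).

(* For invariants it suffices to consider the canonical disjoint copies of two
   graphs, and the induced subgraphs given by vertex subsets. *)
Definition mining : Prop :=
  forall G H, f (dunion G H) = Num.min (f G) (f H).

Definition monotone_decreasing : Prop :=
  forall (G : sgraph) (S : {set G}), f G <= f (induced S).

(* A minimum over a finite family; it is +oo when no X changes f. *)
Definition vs (G : sgraph) : \bar R :=
  \big[Order.min/+oo%E]_(X : {set G} | f (delete X) != f G) (#|X|%:R)%:E.
End Invariants.

(* Main.v *)
Require Import Defs.
From HB Require Import structures.
From mathcomp Require Import all_boot all_order all_algebra.
From mathcomp Require Import reals constructive_ereal.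

Local Open Scope ring_scope.

(** Every graph contains the empty graph as an induced subgraph, so the value
    of [f] at the empty graph is its maximum, and [vs f H = +oo] exactly when
    [f H] equals this maximum. Hence if some [H j] lies outside [J], then
    [f G = min_i f (H i)] is below the maximum, and [I] and [J] are disjoint.
    In that case deleting [X] changes [f G] iff, for each [i] in [I], deleting
    the part of [X] inside [H i] changes [f (H i)]; so the optimal [X] is the
    union of optimal sets of the [H i] with [i] in [I]. *)

Import Order.TTheory GRing.Theory Num.Theory.

Set Implicit Arguments.
Unset Strict Implicit.
Unset Printing Implicit Defensive.

(** * Isomorphisms between empty graphs, induced subgraphs and disjoint unions *)

Lemma isomorphic_sym (G H : sgraph) : isomorphic G H -> isomorphic H G.
Proof.
case=> phi [psi phiK psiK] phi_edge; exists psi; first by exists phi.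
by move=> x y; rewrite -phi_edge !psiK.
Qed.

Lemma void_edge_sym : symmetric (fun _ _ : void => false).
Proof. by []. Qed.

Lemma void_edge_irrefl : irreflexive (fun _ _ : void => false).
Proof. by []. Qed.

Definition empty_graph : sgraph := SGraph void_edge_sym void_edge_irrefl.

Lemma isomorphic_empty (G : sgraph) :
  (G -> False) -> isomorphic empty_graph G.
Proof.
move=> G0; exists (of_void G); last by case.
by exists (fun x => match G0 x with end) => x; [case: x | case: (G0 x)].
Qed.

Lemma isomorphic_induced (G G' : sgraph) (phi : G -> G') (S : {set G'}) :
    bijective phi -> (forall x y, edge (phi x) (phi y) = edge x y) ->
  isomorphic (induced (phi @^-1: S)) (induced S).
Proof.
case=> psi phiK psiK phi_edge.
have fP (x : induced (phi @^-1: S)) : phi (val x) \in S.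
  by have := valP x; rewrite /= inE.
have gP (y : induced S) : psi (val y) \in phi @^-1: S.
  by rewrite inE psiK; exact: (valP y).
exists (fun x => Sub (phi (val x)) (fP x) : induced S).
  exists (fun y => Sub (psi (val y)) (gP y)) => x; apply: val_inj.
    by rewrite /= phiK.
  by rewrite /= psiK.
by move=> x y; exact: phi_edge.
Qed.

(** Splitting off the first summand lets induction on [k] reduce a [k]-fold union to the binary
    unions in [mining]. *)
Lemma isomorphic_bigdunion_recl (k : nat) (H : 'I_k.+1 -> sgraph) :
  isomorphic (dunion (H ord0) (bigdunion (fun i : 'I_k => H (lift ord0 i))))
             (bigdunion H).
Proof.
pose phi (u : dunion (H ord0) (bigdunion (fun i => H (lift ord0 i)))) :
    bigdunion H :=
  match u with
  | inl x => Tagged H x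
  | inr v => existT H (lift ord0 (tag v)) (tagged v)
  end.
have phi_edge u v : edge (phi u) (phi v) = edge u v.
  case: u v => [x|[i x]] [y|[j y]] //=.
  - by rewrite /bigdunion_edge eqxx /= (tagged_asE (T_ := H)).
  - rewrite /bigdunion_edge /= (inj_eq lift_inj); case: eqVneq => //= eq_ij.
    by case: _ / eq_ij y => y; rewrite !tagged_asE.
(* Injectivity and equal cardinalities spare an explicit inverse, which would need a dependent case
   split on the index. *)
exists phi => //; apply: inj_card_bij.
  case=> [x|[i x]] [y|[j y]] //= eq_xy.
    by move/eqP: eq_xy; rewrite eq_Tagged => /eqP /= ->.
  have /= /lift_inj eq_ij := congr1 tag eq_xy.
  case: _ / eq_ij y eq_xy => y eq_xy.
  by move/eqP: eq_xy; rewrite eq_Tagged => /eqP /= ->.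
rewrite card_sum !card_tagged !sumnE !big_map -!enumT !big_enum /=.
by rewrite big_ord_recl.
Qed.

Definition fiber (k : nat) (H : 'I_k -> sgraph) (X : {set bigdunion H})
    (i : 'I_k) : {set H i} :=
  [set x | Tagged H x \in X].

Lemma card_fibers (k : nat) (H : 'I_k -> sgraph) (X : {set bigdunion H}) :
  #|X| = (\sum_i #|fiber X i|)%N.
Proof.
rewrite -sum1_card (eq_bigr (fun i => \sum_(x in fiber X i) 1)%N); last first.
  by move=> i _; rewrite sum1_card.
rewrite sig_big_dep /=; apply: eq_bigl => -[i x] /=; by rewrite inE.
Qed.

(** Deletion acts summand by summand, so [f (delete X)] becomes a minimum over the summands. *)
Lemma isomorphic_delete_bigdunion (k : nat) (H : 'I_k -> sgraph)
    (X : {set bigdunion H}) :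
  isomorphic (bigdunion (fun i => delete (fiber X i))) (delete X).
Proof.
pose D i := delete (fiber X i).
have fP (u : bigdunion D) : Tagged H (val (tagged u)) \in ~: X.
  by have := valP (tagged u); rewrite !inE.
have gP (v : delete X) : tagged (val v) \in ~: fiber X (tag (val v)).
  by have := valP v; rewrite !inE; case: (val v).
exists (fun u : bigdunion D =>
          Sub (Tagged H (val (tagged u))) (fP u) : delete X).
  exists (fun v : delete X =>
            Tagged D (Sub (tagged (val v)) (gP v) : D (tag (val v)))).
    case=> i x; congr existT; exact: val_inj.
  by move=> v; apply: val_inj => /=; case: (val v).
move=> [i x] [j y]; rewrite /= /induced_edge /= /bigdunion_edge /=.
case: eqVneq => //= eq_ij; case: _ / eq_ij y => y.
by rewrite !tagged_asE.
Qed.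

(** * Vertex stability of a single graph *)

Section VertexStability.
Variables (R : realType) (f : sgraph -> R).
Hypothesis f_inv : graph_invariant f.
Hypothesis f_decr : monotone_decreasing f.

Lemma inv_iso (G H : sgraph) : isomorphic G H -> f G = f H.
Proof. by case: f_inv => _; apply. Qed.

Lemma le_empty_graph (G : sgraph) : f G <= f empty_graph.
Proof.
rewrite (@inv_iso empty_graph (induced (set0 : {set G}))); first exact: f_decr.
by apply: isomorphic_empty => -[x]; rewrite inE.
Qed.

Lemma delete_neq (G : sgraph) (X : {set G}) :
  (f (delete X) != f G) = (f G < f (delete X)).
Proof. by rewrite lt_neqAle eq_sym f_decr andbT. Qed.

Lemma inv_deleteT (G : sgraph) : f (delete [set: G]) = f empty_graph.
Proof.
by apply/esym/inv_iso/isomorphic_empty => -[x]; rewrite !inE.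
Qed.

Lemma vs_le (G : sgraph) (X : {set G}) :
  f (delete X) != f G -> (vs f G <= (#|X|%:R)%:E)%E.
Proof. by move=> X_neq; rewrite /vs; apply: bigmin_le_cond. Qed.

(** Deleting all vertices changes [f], so the minimum runs over a nonempty family and the default
    [+oo] is not taken. *)
Lemma vs_attained (G : sgraph) : f G < f empty_graph ->
  exists2 X : {set G}, f (delete X) != f G & vs f G = (#|X|%:R)%:E.
Proof.
move=> ltG; have T_neq : f (delete [set: G]) != f G.
  by rewrite delete_neq inv_deleteT.
rewrite /vs (bigmin_eq_arg _ [set: G]) //; last by move=> X _; exact: leey.
by case: Order.TotalTheory.arg_minP => // X X_neq _; exists X.
Qed.

Lemma vs_eq_pinfty (G : sgraph) :
  (vs f G == +oo%E) = (f G == f empty_graph).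
Proof.
have := le_empty_graph G; rewrite le_eqVlt => /orP[/eqP eqG|ltG].
  rewrite eqG eqxx /vs big_pred0 ?eqxx // => X.
  by rewrite delete_neq eqG ltNge le_empty_graph.
by rewrite (lt_eqF ltG); have [X _ ->] := vs_attained ltG.
Qed.

(** The preimage under [phi] of a set whose deletion changes [f H] has the same size, and its
    deletion changes [f G]. *)
Lemma vs_iso_le (G H : sgraph) : isomorphic G H -> (vs f G <= vs f H)%E.
Proof.
move=> isoGH; have fGH := inv_iso isoGH.
case: isoGH => phi bij_phi phi_edge.
apply/bigmin_geP; split=> [|X X_neq]; first exact: leey.
rewrite -(@on_card_preimset _ _ phi); last exact: onW_bij.
apply: vs_le; rewrite fGH /delete -preimsetC.
by rewrite (inv_iso (isomorphic_induced (~: X) bij_phi phi_edge)).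
Qed.

Lemma vs_iso (G H : sgraph) : isomorphic G H -> vs f G = vs f H.
Proof.
by move=> iso; apply/le_anti; rewrite !vs_iso_le //; exact: isomorphic_sym.
Qed.

(** * Vertex stability of disjoint unions *)

Hypothesis f_mining : mining f.

(** The default [f empty_graph] is the right value for [k = 0]; being the maximum of [f], it does
    not affect the minimum otherwise. *)
Lemma inv_bigdunion (k : nat) (H : 'I_k -> sgraph) :
  f (bigdunion H) = \big[Num.min/f empty_graph]_i f (H i).
Proof.
elim: k H => [|k IHk] H.
  rewrite big_ord0; apply/esym/inv_iso/isomorphic_empty.
  by case; case=> [[]].
rewrite -(inv_iso (isomorphic_bigdunion_recl H)) f_mining IHk.
by rewrite big_ord_recl.
Qed.

Lemma bigdunion_le (k : nat) (H : 'I_k -> sgraph) (i : 'I_k) :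
  f (bigdunion H) <= f (H i).
Proof. by rewrite inv_bigdunion; exact: bigmin_le_cond. Qed.

Lemma delete_bigdunion_neq (k : nat) (H : 'I_k -> sgraph)
    (X : {set bigdunion H}) : f (bigdunion H) < f empty_graph ->
  reflect (forall i, f (H i) = f (bigdunion H) ->
                     f (delete (fiber X i)) != f (H i))
          (f (delete X) != f (bigdunion H)).
Proof.
move=> ltU; rewrite delete_neq -(inv_iso (isomorphic_delete_bigdunion X)).
(* A minimum exceeds [f (bigdunion H)] iff every term and the default do; the default does by
   [ltU]. *)
rewrite [X in _ < X]inv_bigdunion; apply: (iffP (bigmin_gtP _ _ _ _)).
  by case=> _ ltX i eq_i; rewrite eq_i gt_eqF // ltX.
move=> X_neq; split=> // i _.
have := bigdunion_le H i; rewrite le_eqVlt => /orP[/eqP/esym eq_i|lt_i].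
  by rewrite -eq_i -delete_neq X_neq.
(* A summand already above the minimum stays above it, since deletion never lowers [f]. *)
exact: lt_le_trans lt_i (f_decr _).
Qed.

Lemma vs_bigdunion (k : nat) (H : 'I_k -> sgraph) :
    f (bigdunion H) < f empty_graph ->
  vs f (bigdunion H)
    = (\sum_(i | f (H i) == f (bigdunion H)) vs f (H i))%E.
Proof.
move=> ltU; apply/le_anti/andP; split; last first.
  (* Lower bound: each fiber of [X] over a minimizing summand costs at least [vs f (H i)]; the other
     fibers are dropped. *)
  apply/bigmin_geP; split=> [|X /(delete_bigdunion_neq _ ltU) X_neq].
    exact: leey.
  rewrite card_fibers natr_sum -sumEFin.
  apply: (@le_trans _ _
    (\sum_(i | f (H i) == f (bigdunion H)) (#|fiber X i|%:R)%:E)%E).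
    by apply: lee_sum => i /eqP eq_i; apply: vs_le; exact: X_neq.
  rewrite [leRHS](bigID (fun i => f (H i) == f (bigdunion H))) /=.
  by rewrite leeDl // sume_ge0 // => i _; rewrite lee_fin.
(* Upper bound: the condition sits inside the existential so that one [Y i] can be chosen for every
   [i]. *)
have optP i : exists Y : {set H i}, f (H i) == f (bigdunion H) ->
    f (delete Y) != f (H i) /\ vs f (H i) = (#|Y|%:R)%:E.
  have [/eqP eq_i|_] := boolP (f (H i) == f (bigdunion H)); last by exists set0.
  have [|Y Y_neq vsY] := @vs_attained (H i); first by rewrite eq_i.
  by exists Y.
have [Y optY] := fin_all_exists optP.
pose X : {set bigdunion H} :=
  [set u | (f (H (tag u)) == f (bigdunion H)) && (tagged u \in Y (tag u))].
have X_fiber i : fiber X i =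
    if f (H i) == f (bigdunion H) then Y i else set0.
  by apply/setP => x; rewrite !inE /=; case: ifP; rewrite ?inE.
have X_neq : f (delete X) != f (bigdunion H).
  apply/delete_bigdunion_neq => // i /eqP eq_i.
  by rewrite X_fiber eq_i; case: (optY i eq_i).
apply: le_trans (vs_le X_neq) _.
rewrite card_fibers natr_sum -sumEFin [leRHS]big_mkcond.
apply: lee_sum => i _; rewrite X_fiber; case: ifP => [eq_i|_].
  by case: (optY i eq_i) => _ ->.
by rewrite cards0.
Qed.

End VertexStability.

Theorem theorem2p7 (R : realType) (f : sgraph -> R)
    (f_inv : graph_invariant f) (f_mining : mining f)
    (f_decr : monotone_decreasing f)
    (k : nat) (k_ge1 : (1 <= k)%N) (H : 'I_k -> sgraph)
    (G : sgraph) (G_union : isomorphic G (bigdunion H)) :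
  let I := [set i : 'I_k | f (H i) == f G] in
  let J := [set j : 'I_k | vs f (H j) == +oo%E] in
  (J = [set: 'I_k] -> vs f G = +oo%E) /\
  (J <> [set: 'I_k] ->
   vs f G = (\sum_(i in I :\: J) vs f (H i)
             + \sum_(i in I :&: J) (#|H i|%:R)%:E)%E).
Proof.
move=> I J; have fG : f G = f (bigdunion H) := inv_iso f_inv G_union.
have inJ j : (j \in J) = (f (H j) == f empty_graph).
  by rewrite inE vs_eq_pinfty.
split=> [JT|JnT].
  apply/eqP; rewrite vs_eq_pinfty // fG inv_bigdunion //.
  rewrite eq_le bigmin_le_id /=; apply/bigmin_geP; split=> // i _.
  by have := in_setT i; rewrite -JT inJ => /eqP ->.
(* If [f G] were maximal, each [f (H i)], being at least [f G], would be maximal too, forcing [J] to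
   be everything. *)
have ltU : f (bigdunion H) < f empty_graph.
  rewrite lt_neqAle le_empty_graph // andbT; apply/eqP => eqU; apply: JnT.
  apply/setP => i; rewrite inJ inE eq_le le_empty_graph //= -eqU.
  exact: bigdunion_le.
have IJ i : i \in I -> i \notin J.
  by rewrite inJ inE fG => /eqP ->; rewrite lt_eqF.
(* As [I] and [J] are disjoint, the second sum is empty and the first runs over all of [I]. *)
rewrite [X in (_ + X)%E]big_pred0 ?adde0; last first.
  move=> i; rewrite inE; apply/negP => /andP[/IJ iJ].
  by apply/negP.
rewrite (vs_iso f_inv G_union) vs_bigdunion //; apply: eq_bigl => i.
have -> : I :\: J = I.
  by apply/setDidPl; rewrite disjoint_subset; apply/subsetP => j /IJ.
by rewrite inE fG.
Qed.
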